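(* Let $G$ be a locally compact group and $\phi$ a continuous endomorphism of $G$. Then $$H_{alg}(\phi,U)=\lim_{n\to\infty}\frac{\log[T_n(\phi,U):U]}{n}$$ for every compact open subgroup $U$ of $G$ that is topologically quasinormal in $G$. If $G$ is also compactly covered and topologically quasihamiltonian, then $$h_{alg}(\phi)=\sup\{H_{alg}(\phi,U) : U \text{ is a compact open subgroup of } G\}.$$
   Context: All topological groups are Hausdorff. A topological group is compactly covered if each of its elements lies in a compact subgroup. A closed subgroup $N$ of a topological group $G$ is topologically quasinormal if $\overline{NL}=\overline{LN}$ for every closed subgroup $L$ of $G$; $G$ is topologically quasihamiltonian if every closed subgroup of $G$ is topologically quasinormal. For $U\subseteq G$ and $n\geq 1$ put $T_n(\phi,U)=U\cdot\phi(U)\cdots\phi^{n-1}(U)$. If $U$ is a subgroup and $T\subseteq G$ is a disjoint union of right cosets of $U$, then $[T:U]$ denotes the number of those cosets (the usual index when $T$ is a subgroup). Algebraic entropy: let $\mu$ be a right Haar measure on $G$. For $U$ a compact neighborhood of $e_G$ put $H_{alg}(\phi,U)=\limsup_{n\to\infty}\frac{\log\mu(T_n(\phi,U))}{n}$, and let $h_{alg}(\phi)\in[0,\infty]$ be the supremum of $H_{alg}(\phi,U)$ over all compact neighborhoods $U$ of $e_G$. *)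

(* Defs.v *)
From HB Require Import structures.
From mathcomp Require Import all_boot all_order all_algebra.
From mathcomp Require Import all_classical all_reals all_analysis.
Set Implicit Arguments.
Unset Strict Implicit.
Unset Printing Implicit Defensive.
Import Order.TTheory GRing.Theory Num.Theory.
Local Open Scope classical_set_scope.
Local Open Scope group_scope.

(* The base point inherited from [PointedTopological] is unconstrained and plays
   no role; it is there because [g_sigma_algebraType] asks for a pointed type. *)
HB.mixin Record PointedTopological_isTopologicalGroup (G : Type)
    of PointedTopological G & Group G := {
  mulg_continuous : continuous (fun z : G * G => z.1 * z.2) ;
  invg_continuous : continuous (fun x : G => x^-1) }.

#[short(type="topologicalGroupType")]
HB.structure Definition TopologicalGroup :=
  {G of PointedTopological G & Group G &
        PointedTopological_isTopologicalGroup G}.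

Definition borelType (G : topologicalGroupType) := g_sigma_algebraType (@open G).

Section TopologicalGroups.
Variable G : topologicalGroupType.
Implicit Types (U N L A B T : set G) (x : G).

Definition subgroup U : Prop := group_closed (mem U).

Definition mulset A B : set G := [set a * b | a in A & b in B].

Definition right_coset U x : set G := [set u * x | u in U].

Definition topologically_quasinormal N : Prop :=
  [/\ closed N, subgroup N &
      forall L, closed L -> subgroup L ->
        closure (mulset N L) = closure (mulset L N)].

Definition topologically_quasihamiltonian : Prop :=
  forall N, closed N -> subgroup N -> topologically_quasinormal N.

Definition compactly_covered : Prop :=
  forall x, exists K, [/\ compact K, subgroup K & K x].

(* [Tn phi U 0] is the empty product; only the values at n >= 1 matter. *)
Fixpoint Tn (phi : G -> G) U (n : nat) : set G :=
  if n is m.+1 then mulset (Tn phi U m) (iter m phi @` U) else [set 1].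

Variable R : realType.

(* The number of right cosets of [U] making up [T]; +oo if there are
   infinitely many. *)
Definition coset_index T U : \bar R := counting [set right_coset U x | x in T].

Record right_Haar_measure (mu : {measure set (borelType G) -> \bar R}%R) : Prop := {
  right_Haar_neq0 : mu setT <> 0%E ;
  right_Haar_invariant : forall (A : set (borelType G)) (x : G),
    measurable A -> mu (right_coset A x) = mu A ;
  right_Haar_compact : forall K : set G, compact K -> (mu K < +oo)%E ;
  right_Haar_outer_regular : forall A : set (borelType G), measurable A ->
    mu A = ereal_inf [set mu V | V in [set V : set G | open V /\ A `<=` V]] ;
  right_Haar_inner_regular : forall V : set G, open V ->
    mu V = ereal_sup [set mu K | K in [set K : set G | compact K /\ K `<=` V]] }.

Definition H_alg (mu : set (borelType G) -> \bar R) (phi : G -> G) U : \bar R :=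
  limn_esup (fun n => lne (mu (Tn phi U n)) * (n%:R^-1)%R%:E)%E.

Definition h_alg (mu : set (borelType G) -> \bar R) (phi : G -> G) : \bar R :=
  ereal_sup [set H_alg mu phi U | U in [set U | compact U /\ nbhs (1 : G) U]].

End TopologicalGroups.
Arguments coset_index {G R} T U.
Arguments topologically_quasihamiltonian G : clear implicits.
Arguments compactly_covered G : clear implicits.

(* Main.v *)
Require Import Defs.
From mathcomp Require Import all_boot all_order all_algebra.
From mathcomp Require Import finmap.
From mathcomp Require Import all_classical all_reals all_analysis.
Import Order.TTheory GRing.Theory Num.Theory numFieldNormedType.Exports.
Local Open Scope classical_set_scope.
Local Open Scope ring_scope.

Set Implicit Arguments.
Unset Strict Implicit.

(** The limit exists because the sets [Tn phi U n], n >= 1, are compact unions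
of right cosets of [U], and the number t_n of these cosets is almost
submultiplicative. Indeed T_(n+m) = T_n phi^n(T_m) ([TnD]). If m >= 1 and T_m is the
union of the cosets U x for x in F, then T_(n+m) is the union of the sets
T_n phi^n(U) phi^n(x) = T_(n+1) phi^n(x), which are right translates of T_(n+1).
Hence t_(n+m) <= t_(n+1) t_m ([ncosets_TnD]), so log t_(n+1) is subadditive and
log t_n / n converges by Fekete's lemma ([subadditive_divn]). Since
mu(T_n) = t_n mu(U) with 0 < mu(U) < +oo, replacing t_n by mu(T_n) changes
log t_n / n by the vanishing term log mu(U) / n.

For the second formula, H_alg is monotone in its set argument, so it suffices
that every compact neighborhood K of 1 lies in a compact open subgroup
([compact_sub_compact_open_subgroup]). In a quasihamiltonian group two compact
subgroups commute as sets, so their product is a compact subgroup; together with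
compact covering this puts every finite set into a compact subgroup
([finite_sub_compact_subgroup]). Let V be the union of K and its inverse. The
compact set V V is covered by finitely many translates of K, so V V lies in V C
for some compact subgroup C, and then V (V C) lies in V C. The subgroup of
elements that permute the compact set V C by left multiplication contains V, is
contained in V C, and is therefore open, closed and compact. *)

(** * Products, cosets and the sets T_n in a topological group *)

Section TopologicalGroup.
Local Open Scope group_scope.
Variable G : topologicalGroupType.
Implicit Types (A B C K L T U : set G) (x y : G).

Lemma subgroupP U : subgroup U <->
  U 1 /\ forall x y, U x -> U y -> U (x * y^-1).
Proof.
split=> -[U1 Udiv]; split.
- by move: U1; rewrite inE.
- by move=> x y Ux Uy; have := Udiv x y (mem_set Ux) (mem_set Uy); rewrite inE.
- by rewrite inE.
- by move=> x y; rewrite !inE; apply: Udiv.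
Qed.

Lemma subgroup1 U : subgroup U -> U 1.
Proof. by case/subgroupP. Qed.

Lemma subgroupV U x : subgroup U -> U x -> U x^-1.
Proof. by move=> /subgroupP[U1 Udiv] Ux; rewrite -[x^-1]mul1g; apply: Udiv. Qed.

Lemma subgroupM U x y : subgroup U -> U x -> U y -> U (x * y).
Proof.
move=> sU Ux Uy; case/subgroupP: (sU) => _ Udiv.
by rewrite -[y]invgK; apply: Udiv => //; apply: subgroupV.
Qed.

Lemma mulsetA A B C : mulset A (mulset B C) = mulset (mulset A B) C.
Proof.
apply/seteqP; split=> [_ [a Aa [_ [b Bb [c Cc <-]] <-]]|].
  by exists (a * b); [exists a => //; exists b | exists c => //; rewrite mulgA].
move=> _ [_ [a Aa [b Bb <-]] [c Cc <-]].
by exists a => //; exists (b * c); [exists b => //; exists c | rewrite mulgA].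
Qed.

Lemma mulsetS A B C D : A `<=` B -> C `<=` D -> mulset A C `<=` mulset B D.
Proof. by move=> AB CD _ [a /AB Ba [c /CD Dc <-]]; exists a => //; exists c. Qed.

Lemma mulset_subgroup U : subgroup U -> mulset U U = U.
Proof.
move=> sU; apply/seteqP; split=> [_ [x Ux [y Uy <-]]|x Ux].
  exact: subgroupM.
by exists 1; [exact: subgroup1|exists x; rewrite ?mul1g].
Qed.

Lemma right_cosetE U x : right_coset U x = [set y | U (y * x^-1)].
Proof.
apply/seteqP; split=> [_ [u Uu <-]|y /= Uy]; first by rewrite /= mulgK.
by exists (y * x^-1) => //; rewrite mulgVK.
Qed.

Lemma right_coset_refl U x : subgroup U -> right_coset U x x.
Proof. by move=> sU; rewrite right_cosetE/= mulgV; apply: subgroup1. Qed.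

Lemma right_coset_eq U x y :
  subgroup U -> right_coset U x y -> right_coset U y = right_coset U x.
Proof.
rewrite !right_cosetE => sU /= Uyx; apply/seteqP; split=> z /= Uz.
  by rewrite -(mulgVK y z) -mulgA; apply: subgroupM.
have := subgroupM sU Uz (subgroupV sU Uyx).
by rewrite invgM invgK mulgA mulgVK.
Qed.

Lemma mulset_right_coset A B x :
  mulset A (right_coset B x) = right_coset (mulset A B) x.
Proof.
apply/seteqP; split=> [_ [a Aa [_ [b Bb <-] <-]]|_ [_ [a Aa [b Bb <-]] <-]].
  by exists (a * b); [exists a => //; exists b|rewrite mulgA].
by exists a => //; exists (b * x); [exists b|rewrite mulgA].
Qed.

Lemma mulr_continuous x : continuous (fun y : G => y * x).
Proof.
move=> y; apply: (@continuous_comp _ _ _ (fun y : G => (y, x))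
  (fun z : G * G => z.1 * z.2)).
  by apply: cvg_pair; [exact: cvg_id|exact: cvg_cst].
exact: mulg_continuous.
Qed.

Lemma compact_right_coset K x : compact K -> compact (right_coset K x).
Proof.
move=> cK; apply: (@continuous_compact _ _ (fun y : G => y * x)) => //.
exact/continuous_subspaceT/mulr_continuous.
Qed.

Lemma open_right_coset U x : open U -> open (right_coset U x).
Proof.
move=> oU; rewrite right_cosetE.
by apply: (@open_comp _ _ (fun y : G => y * x^-1)) => // y _; exact: mulr_continuous.
Qed.

Lemma mulset_compact A B : compact A -> compact B -> compact (mulset A B).
Proof.
move=> cA cB; have -> : mulset A B = (fun z : G * G => z.1 * z.2) @` (A `*` B).
  apply/seteqP; split=> [_ [a Aa [b Bb <-]]|_ [[a b] [/= Aa Bb] <-]].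
    by exists (a, b).
  by exists a => //; exists b.
apply: continuous_compact; last exact: compact_setX.
exact/continuous_subspaceT/mulg_continuous.
Qed.

(** The translates of [U] form an open cover of [K]. Stated for any open set
containing 1, so as to apply to the interior of a neighborhood. *)
Lemma compact_right_cosets K U : compact K -> open U -> U 1 ->
  exists2 F : set G, finite_set F /\ F `<=` K &
    K `<=` \bigcup_(x in F) right_coset U x.
Proof.
rewrite compact_cover => cK oU U1.
have [|x Kx|D DK KD] := cK G K (right_coset U).
- by move=> x _; apply: open_right_coset.
- by exists x => //; rewrite right_cosetE/= mulgV.
- exists [set` D] => //; split; first exact: finite_fset.
  by move=> x /= /DK; rewrite inE.
Qed.

Definition cosets T U : set (set G) := [set right_coset U x | x in T].

Lemma finite_cosets T U :
  compact T -> open U -> subgroup U -> finite_set (cosets T U).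
Proof.
move=> cT oU sU.
have [F [finF FT] TF] := compact_right_cosets cT oU (subgroup1 sU).
apply: sub_finite_set (finite_image (right_coset U) finF).
by move=> _ [x /TF[y Fy yx] <-]; exists y => //; rewrite (right_coset_eq sU yx).
Qed.

Lemma bigcup_cosets T U : subgroup U -> mulset U T `<=` T ->
  \bigcup_(c in cosets T U) c = T.
Proof.
move=> sU UT; apply/seteqP; split=> [y [_ [x Tx <-] [u Uu <-]]|x Tx].
  by apply: UT; exists u => //; exists x.
by exists (right_coset U x); [exists x|apply: right_coset_refl].
Qed.

Lemma trivIset_cosets T U : subgroup U -> trivIset (cosets T U) id.
Proof.
move=> sU _ _ [x _ <-] [y _ <-] [z [/= xz yz]].
by rewrite -(right_coset_eq sU xz) -(right_coset_eq sU yz).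
Qed.

Section Endomorphism.
Variable phi : {multiplicative G -> G}.

Lemma iter_gmulfM n : {morph iter n phi : x y / x * y}.
Proof. by elim: n => [//|n IH] x y /=; rewrite IH gmulfM. Qed.

Lemma iter_gmulf1 n : iter n phi 1 = 1.
Proof.
have phi1 : phi 1 = 1 by apply: (mulgI (phi 1)); rewrite -gmulfM !mulg1.
by elim: n => [//|n IH] /=; rewrite IH.
Qed.

Lemma iter_image_mulset n A B :
  iter n phi @` mulset A B = mulset (iter n phi @` A) (iter n phi @` B).
Proof.
apply/seteqP; split=> [_ [_ [a Aa [b Bb <-]] <-]|].
  rewrite iter_gmulfM; exists (iter n phi a); first by exists a.
  by exists (iter n phi b) => //; exists b.
move=> _ [_ [a Aa <-] [_ [b Bb <-] <-]].
by exists (a * b); rewrite ?iter_gmulfM//; exists a => //; exists b.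
Qed.

(** Splitting after the first n factors: the remaining factors
phi^n(U) ... phi^(n+m-1)(U) form the image of T_m under phi^n. *)
Lemma TnD U n m :
  Tn phi U (n + m) = mulset (Tn phi U n) (iter n phi @` Tn phi U m).
Proof.
elim: m => [|m IH].
  rewrite addn0/= image_set1 iter_gmulf1; apply/seteqP.
  split=> [x Tx|_ [x Tx [_ -> <-]]]; last by rewrite mulg1.
  by exists x => //; exists 1; rewrite ?mulg1.
rewrite addnS/= IH iter_image_mulset mulsetA; congr mulset.
by rewrite image_comp; apply: eq_imagel => x _; rewrite iterD.
Qed.

Lemma Tn1 U : Tn phi U 1 = U.
Proof.
apply/seteqP; split=> [_ [_ -> [_ [u Uu <-] <-]]|u Uu]; first by rewrite mul1g.
by exists 1 => //; exists u; [exists u|rewrite mul1g].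
Qed.

Lemma TnS U n : Tn phi U n.+1 = mulset U (phi @` Tn phi U n).
Proof. by rewrite -add1n TnD Tn1. Qed.

(** This is why T_n is a union of right cosets of [U]: its first factor is [U].
The empty product T_0 is not saturated in this sense. *)
Lemma mulset_Tn U n : subgroup U -> mulset U (Tn phi U n.+1) = Tn phi U n.+1.
Proof. by move=> sU; rewrite TnS mulsetA mulset_subgroup. Qed.

Lemma Tn_sub A B n : A `<=` B -> Tn phi A n `<=` Tn phi B n.
Proof.
by move=> AB; elim: n => [//|n IH] /=; apply: mulsetS => //; apply: image_subset.
Qed.

Lemma Tn_compact A n : continuous phi -> compact A -> compact (Tn phi A n).
Proof.
move=> phic cA; elim: n => [|n IH]; first exact: compact_set1.
rewrite TnS; apply: mulset_compact => //.
apply: continuous_compact => //; exact: continuous_subspaceT.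
Qed.

Lemma Tn_neq0 A n : A !=set0 -> Tn phi A n !=set0.
Proof.
move=> [a Aa]; elim: n => [|n [x Tx]]; first by exists 1.
by exists (x * iter n phi a); exists x => //; exists (iter n phi a) => //; exists a.
Qed.

End Endomorphism.
End TopologicalGroup.

(** * Compact open subgroups of quasihamiltonian groups *)

Section CompactOpenSubgroup.
Local Open Scope group_scope.
Variable G : topologicalGroupType.
Implicit Types (C D K U V : set G).

Lemma subgroup_mulset C D : subgroup C -> subgroup D ->
  mulset C D = mulset D C -> subgroup (mulset C D).
Proof.
move=> sC sD CD; apply/subgroupP; split.
  by exists 1; [exact: subgroup1|exists 1; rewrite ?mulg1//; exact: subgroup1].
move=> _ _ [c Cc [d Dd <-]] [c' Cc' [d' Dd' <-]].
have : mulset D C (d * (c' * d')^-1).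
  exists (d * d'^-1).
    by apply: subgroupM => //; apply: subgroupV.
  by exists c'^-1; [exact: subgroupV|rewrite invgM mulgA].
rewrite -CD => -[c2 Cc2 [d2 Dd2 e]].
by exists (c * c2); [exact: subgroupM|exists d2 => //; rewrite -!mulgA e].
Qed.

(** Products of compact sets are compact, hence closed, so the closures in the
definition of topological quasinormality can be dropped. *)
Lemma quasihamiltonian_mulsetC C D : hausdorff_space G ->
  topologically_quasihamiltonian G -> compact C -> compact D ->
  subgroup C -> subgroup D -> mulset C D = mulset D C.
Proof.
move=> hG qG cC cD sC sD.
have [_ _ /(_ D)] := qG C (compact_closed hG cC) sC.
have closure_mulset (A B : set G) : compact A -> compact B ->
    closure (mulset A B) = mulset A B.
  move=> cA cB; apply/esym; rewrite -closure_id.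
  exact: compact_closed hG (mulset_compact cA cB).
by rewrite !closure_mulset//; apply => //; exact: compact_closed.
Qed.

(** Adding one element x to a finite set contained in [C] amounts to replacing
[C] by its product with a compact subgroup containing x. *)
Lemma finite_sub_compact_subgroup (F : set G) : hausdorff_space G ->
  compactly_covered G -> topologically_quasihamiltonian G -> finite_set F ->
  exists C, [/\ compact C, subgroup C & F `<=` C].
Proof.
move=> hG ccG qG /finite_seqP[s ->]; elim: s => [|x s [C [cC sC FC]]].
  exists [set 1]; split=> //; first exact: compact_set1.
  by apply/subgroupP; split=> // _ _ -> ->; rewrite mulgV.
have [D [cD sD Dx]] := ccG x.
exists (mulset C D); split; first exact: mulset_compact.
  by apply: subgroup_mulset => //; apply: quasihamiltonian_mulsetC.
move=> y; rewrite /= inE => /orP[/eqP->|ys].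
  by exists 1; [exact: subgroup1|exists x; rewrite ?mul1g].
by exists y; [exact: FC|exists 1; rewrite ?mulg1//; exact: subgroup1].
Qed.

Lemma open_subgroup U : subgroup U -> nbhs (1 : G) U -> open U.
Proof.
move=> sU U1; rewrite openE => x Ux.
apply: (@filterS _ _ _ (right_coset (interior U) x)).
  move=> _ [u /interior_subset Uu <-]; exact: subgroupM.
apply: open_nbhs_nbhs; split; first exact/open_right_coset/open_interior.
by exists 1; rewrite ?mul1g.
Qed.

(** The complement is a union of cosets, all of them open. *)
Lemma closed_open_subgroup U : subgroup U -> open U -> closed U.
Proof.
move=> sU oU y /(_ (right_coset U y)).
case=> [|z [Uz]].
  apply: open_nbhs_nbhs; split; first exact: open_right_coset.
  exact: right_coset_refl.
rewrite right_cosetE/= => /(subgroupV sU); rewrite invgM invgK => Uyz.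
by rewrite -[y](mulgVK z); apply: subgroupM.
Qed.

(** The step that produces compactness: a compact set stable under left
multiplication by [K] and its inverses bounds the subgroup they generate. *)
Lemma compact_sub_compact_open_subgroup K : hausdorff_space G ->
  compactly_covered G -> topologically_quasihamiltonian G ->
  compact K -> nbhs (1 : G) K ->
  exists U, [/\ compact U, open U, subgroup U & K `<=` U].
Proof.
move=> hG ccG qG cK K1.
pose V := K `|` [set x^-1 | x in K].
have cV : compact V.
  apply: compactU => //; apply: continuous_compact => //.
  exact/continuous_subspaceT/invg_continuous.
have V1 : V 1 by left; exact: nbhs_singleton.
have VV x : V x -> V x^-1.
  by case=> [Kx|[y Ky <-]]; [right; exists x|left; rewrite invgK].
have [F [finF _] VF] := compact_right_cosets (mulset_compact cV cV)
  (@open_interior _ K) K1.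
have [C [cC sC FC]] := finite_sub_compact_subgroup hG ccG qG finF.
(* V S is contained in V V C, which lies in V C C = S by the choice of C. *)
pose S := mulset V C.
have VS x s : V x -> S s -> S (x * s).
  move=> Vx [v Vv [c Cc <-]].
  have [f Ff [k Kk vk]] : (\bigcup_(x in F) right_coset (interior K) x) (x * v).
    by apply: VF; exists x => //; exists v.
  exists k; first by left; exact: interior_subset.
  exists (f * c); first by apply: subgroupM => //; apply: FC.
  by rewrite mulgA vk mulgA.
have S1 : S 1 by exists 1 => //; exists 1; rewrite ?mulg1//; exact: subgroup1.
(* The stabilizer of S for left translation; it lies in S because 1 does. *)
pose U := [set x | forall s, S s -> S (x * s) /\ S (x^-1 * s)].
have sU : subgroup U.
  apply/subgroupP; split=> [s Ss|x y Ux Uy s Ss]; first by rewrite invg1 mul1g.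
  rewrite invgM invgK -!mulgA; split.
    by apply Ux; apply Uy.
  by apply Uy; apply Ux.
have VU : V `<=` U by move=> x Vx s Ss; split; apply: VS => //; apply: VV.
have KU : K `<=` U by move=> x Kx; apply: VU; left.
have oU : open U by apply: open_subgroup => //; apply: filterS K1.
have US : U `<=` S by move=> x /(_ 1 S1)[]; rewrite mulg1.
exists U; split=> //; apply: (subclosed_compact _ (mulset_compact cV cC)) => //.
exact: closed_open_subgroup.
Qed.

End CompactOpenSubgroup.

(** * Haar measure and the number of cosets *)

Section Haar.
Local Open Scope group_scope.
Variables (R : realType) (G : topologicalGroupType).
Variable mu : {measure set (borelType G) -> \bar R}%R.
Hypotheses (hausG : hausdorff_space G) (haar : right_Haar_measure mu).
Implicit Types (K T U : set G).

Lemma open_borel U : open U -> measurable (U : set (borelType G)).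
Proof. by move=> oU; apply: sub_gen_smallest. Qed.

Lemma compact_borel K : compact K -> measurable (K : set (borelType G)).
Proof.
move=> cK; rewrite -[K]setCK; apply: measurableC; apply: open_borel.
exact/closed_openC/(compact_closed hausG).
Qed.

Lemma haar_compact_fin_num K : compact K -> mu K \is a fin_num.
Proof. by move=> cK; rewrite ge0_fin_numE//; exact: right_Haar_compact. Qed.

(** If [mu U] vanished, every compact set would be null, being covered by
finitely many translates of [U]; inner regularity would then make [mu] zero. *)
Lemma haar_open_gt0 U : open U -> U 1 -> (0 < mu U)%E.
Proof.
move=> oU U1; rewrite lt0e measure_ge0 andbT; apply/negP => /eqP muU0.
apply: (right_Haar_neq0 haar).
rewrite (right_Haar_inner_regular haar); last exact: openT.
apply/eqP; rewrite eq_le; apply/andP; split; last first.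
  apply: ereal_sup_ubound; exists set0; last by rewrite measure0.
  by split; [exact: compact0|exact: sub0set].
apply: ge_ereal_sup => _ [K [cK _] <-].
have [F [finF _] KF] := compact_right_cosets cK oU U1.
have mUx x : measurable (right_coset U x : set (borelType G)).
  by apply: open_borel; exact: open_right_coset.
have muK : (mu K <= \sum_(x \in F) mu (right_coset U x))%E.
  by apply: content_sub_fsum => //; exact: compact_borel.
apply: (le_trans muK).
rewrite fsume_le0// => x _.
by rewrite (right_Haar_invariant haar)//; [rewrite muU0|exact: open_borel].
Qed.

Lemma fine_haar_gt0 U : compact U -> open U -> U 1 -> (0 < fine (mu U))%R.
Proof.
move=> cU oU U1; apply: fine_gt0; rewrite haar_open_gt0//=.
exact: right_Haar_compact.
Qed.

Definition ncosets T U : nat := #|` fset_set (cosets T U)|.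

Lemma coset_indexE T U : compact T -> open U -> subgroup U ->
  coset_index T U = (ncosets T U)%:R%:E :> \bar R.
Proof.
move=> cT oU sU; rewrite /coset_index /counting; case: asboolP => //.
by case; exact: finite_cosets.
Qed.

Lemma fsum_cosets T U (f : set G -> \bar R) (r : R) :
  compact T -> open U -> subgroup U ->
  (forall c, cosets T U c -> f c = r%:E) ->
  (\sum_(c \in cosets T U) f c = (r *+ ncosets T U)%R%:E)%E.
Proof.
move=> cT oU sU fr; have finC := finite_cosets cT oU sU.
rewrite (eq_fsbigr (fun=> r%:E)); last by move=> c /set_mem/fr.
rewrite fsbig_finite//= sumEFin; congr EFin.
by rewrite big_const_seq count_predT GRing.iter_addr_0.
Qed.

(** The saturated set [T] is the disjoint union of finitely many translates of
[U], each of measure [mu U]. *)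
Lemma measure_ncosets T U : compact T -> open U -> compact U -> subgroup U ->
  mulset U T `<=` T -> mu T = (fine (mu U) *+ ncosets T U)%R%:E.
Proof.
move=> cT oU cU sU UT.
have mC c : cosets T U c -> measurable (c : set (borelType G)).
  by move=> [x _ <-]; apply: open_borel; exact: open_right_coset.
rewrite -[in LHS](bigcup_cosets sU UT) measure_fin_bigcup//.
- apply: fsum_cosets => // _ [x _ <-] /=.
  rewrite (right_Haar_invariant haar) ?fineK//; first exact: haar_compact_fin_num.
  exact: open_borel.
- exact: finite_cosets.
- exact: trivIset_cosets.
Qed.

Section Endomorphism.
Variable phi : {multiplicative G -> G}.
Hypothesis phi_cont : continuous phi.
Variable U : set G.
Hypotheses (cU : compact U) (oU : open U) (sU : subgroup U).

Let t n := ncosets (Tn phi U n) U.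

Lemma measure_Tn n : mu (Tn phi U n.+1) = (fine (mu U) *+ t n.+1)%R%:E.
Proof.
by apply: measure_ncosets => //; [exact: Tn_compact|rewrite mulset_Tn].
Qed.

Lemma ncosets_Tn_gt0 n : (0 < t n)%N.
Proof.
have [x Tx] := Tn_neq0 phi n (ex_intro _ 1 (subgroup1 sU)).
rewrite lt0n; apply/negP => /eqP/cardfs0_eq/(congr1 (fun A => [set` A])).
rewrite fset_setK; last by apply: finite_cosets => //; exact: Tn_compact.
by rewrite set_fset0 => /seteqP[/(_ (right_coset U x))] h _; apply: h; exists x.
Qed.

(** Writing T_(m+1) as a union of cosets U x covers T_(n+m+1) by the
translates T_(n+1) phi^n(x), because T_n phi^n(U) = T_(n+1). Comparing
measures and dividing by [mu U] gives the bound. *)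
Lemma ncosets_TnD n m : (t (n + m.+1) <= t n.+1 * t m.+1)%N.
Proof.
have cT k : compact (Tn phi U k) by exact: Tn_compact.
have mT k : measurable (Tn phi U k : set (borelType G)) by exact: compact_borel.
pose f c : set G := mulset (Tn phi U n) (iter n phi @` c).
have fE x : f (right_coset U x) = right_coset (Tn phi U n.+1) (iter n phi x).
  rewrite /f /= -mulset_right_coset; congr mulset.
  apply/seteqP; split=> [_ [_ [u Uu <-] <-]|_ [_ [u Uu <-] <-]].
    by rewrite iter_gmulfM; exists (iter n phi u) => //; exists u.
  by exists (u * x); rewrite ?iter_gmulfM//; exists u.
have le_mu : (mu (Tn phi U (n + m.+1)) <=
    \sum_(c \in cosets (Tn phi U m.+1) U) mu (f c))%E.
  apply: content_sub_fsum => //; first exact: finite_cosets.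
    move=> _ [x _ <-]; rewrite fE; apply: compact_borel.
    exact: compact_right_coset (cT n.+1).
  rewrite TnD => _ [x Tx [_ [y Ty <-] <-]].
  exists (right_coset U y); first by exists y.
  exists x => //; exists (iter n phi y) => //; exists y => //.
  exact: right_coset_refl.
rewrite (@fsum_cosets _ _ _ (fine (mu U) *+ t n.+1)%R) // in le_mu; first last.
  move=> _ [x _ <-]; rewrite fE (right_Haar_invariant haar)//.
  exact: measure_Tn.
move: le_mu; rewrite addnS measure_Tn -addnS lee_fin -mulrnA.
by rewrite ler_pMn2l// fine_haar_gt0//; exact: subgroup1.
Qed.

End Endomorphism.
End Haar.

(** * Subadditive sequences *)

Section Fekete.
Local Open Scope ring_scope.
Variable R : realType.

(** Fekete's lemma: the limit is the infimum l of a_k / k for k >= 1. If a_k / k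
is within e/2 of l, then Euclidean division of n by k bounds a_n / n by a_k / k
plus B / n, where B bounds the value of a at the remainder. *)
Lemma subadditive_divn (a : nat -> R) : (forall n, 0 <= a n) ->
  (forall m n, a (m + n)%N <= a m + a n) ->
  exists l : R, (fun n => a n / n%:R) @ \oo --> l.
Proof.
move=> a0 aD.
have aM q m r : a (q * m + r)%N <= q%:R * a m + a r.
  elim: q => [|q IH]; first by rewrite mul0n mul0r add0r.
  rewrite mulSn -addnA (le_trans (aD _ _))// -natr1 mulrDl mul1r.
  by rewrite [X in _ <= X + _]addrC -addrA lerD2l.
pose S := [set a n.+1 / n.+1%:R | n in [set: nat]].
have infS : has_inf S.
  split; first by exists (a 1 / 1), 0%N.
  by exists 0 => _ [n _ <-]; rewrite divr_ge0.
exists (inf S); apply/cvgrPdist_lt => e e0.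
have e20 : 0 < e / 2 by rewrite divr_gt0.
have [_ [m _ <-] am] := inf_adherent e20 infS.
pose B := \sum_(r < m.+1) a r.
have B0 : 0 <= B by apply: sumr_ge0.
near=> n.
have n0 : (0 < n)%N by near: n; exists 1%N.
have nR : 0 < n%:R :> R by rewrite ltr0n.
have ln : inf S <= a n / n%:R.
  apply: ge_inf; first by case: infS.
  by exists n.-1 => //; rewrite prednK.
have Bn : B / n%:R < e / 2.
  rewrite ltr_pdivrMr// mulrC -ltr_pdivrMr//.
  near: n; exact: nbhs_infty_gtr.
have un : a n / n%:R <= a m.+1 / m.+1%:R + B / n%:R.
  rewrite ler_pdivrMr// mulrDl divfK ?gt_eqF// [X in a X](divn_eq n m.+1).
  rewrite (le_trans (aM _ _ _))// lerD//.
    rewrite [leRHS]mulrAC -[leRHS]mulrA [leLHS]mulrC ler_wpM2l//.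
    by rewrite ler_pdivlMr// -natrM ler_nat leq_divM.
  have rm : (n %% m.+1 < m.+1)%N by rewrite ltn_pmod.
  rewrite /B (bigD1 (Ordinal rm))//= lerDl; exact: sumr_ge0.
rewrite distrC ger0_norm ?subr_ge0// ltrBlDl (le_lt_trans un)//.
by rewrite [e](splitr) addrA ltrD.
Unshelve. all: by end_near. Qed.

(** Fekete's lemma for n |-> a_(n+1), whose quotients by n and by n + 1 differ
by the factor n / (n + 1), which tends to 1. *)
Lemma shifted_subadditive_divn (a : nat -> R) : (forall n, 0 <= a n) ->
  (forall m n, a (m + n).+1 <= a m.+1 + a n.+1) ->
  exists l : R, (fun n => a n / n%:R) @ \oo --> l.
Proof.
move=> a0 aD.
have [l al] := @subadditive_divn (fun n => a n.+1) (fun n => a0 n.+1) aD.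
exists l; rewrite -cvg_shiftS/=.
have hl : (fun n => a n.+1 / n%:R * (1 - @harmonic R n)) @ \oo --> l * (1 - 0).
  apply: cvgM => //; apply: cvgB; [exact: cvg_cst|exact: cvg_harmonic].
rewrite subr0 mulr1 in hl.
apply: cvg_trans hl; apply: near_eq_cvg; near=> n.
have n0 : n%:R != 0 :> R.
  by rewrite pnatr_eq0 -lt0n; near: n; exists 1%N.
rewrite /harmonic -mulrA; congr (_ * _).
have n1 : n.+1%:R != 0 :> R by rewrite pnatr_eq0.
have -> : 1 - n.+1%:R^-1 = n%:R / n.+1%:R :> R.
  by apply: (mulIf n1); rewrite mulrBl mul1r mulVf// divfK// -natr1 addrK.
by rewrite mulrA mulVf// mul1r.
Unshelve. all: by end_near. Qed.

End Fekete.

(** * Algebraic entropy *)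

Section Entropy.
Local Open Scope ring_scope.
Variables (R : realType) (G : topologicalGroupType).
Variable mu : {measure set (borelType G) -> \bar R}.
Hypotheses (hausG : hausdorff_space G) (haar : right_Haar_measure mu).
Variable phi : {multiplicative G -> G}.
Hypothesis phi_cont : continuous phi.
Implicit Types (K U : set G).

Lemma H_alg_subset K U : compact K -> compact U -> K `<=` U ->
  (H_alg mu phi K <= H_alg mu phi U)%E.
Proof.
move=> cK cU KU; rewrite /H_alg !limn_esup_lim.
apply: lee_lim; [exact: is_cvg_esups|exact: is_cvg_esups|apply: nearW => n].
apply: ge_ereal_sup => _ [m /= nm <-].
apply: le_trans (ereal_sup_ubound _); last by exists m; [exact: nm|].
apply: lee_wpmul2r; first by rewrite lee_fin invr_ge0.
rewrite lee_lne ?in_itv/= ?measure_ge0 ?leey//.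
rewrite le_measure ?inE//; last exact: Tn_sub.
- by apply: compact_borel => //; exact: Tn_compact.
- by apply: compact_borel => //; exact: Tn_compact.
Qed.

Lemma cvg_coset_index U : compact U -> open U -> subgroup U ->
  (fun n => lne (coset_index (Tn phi U n) U) * (n%:R^-1)%R%:E)%E @ \oo -->
    H_alg mu phi U.
Proof.
move=> cU oU sU.
pose t n := ncosets (Tn phi U n) U.
have t0 n : (0 : R) < (t n)%:R by rewrite ltr0n; exact: ncosets_Tn_gt0.
have [l lnt] : exists l : R, (fun n => ln (t n)%:R / n%:R :> R) @ \oo --> l.
  apply: shifted_subadditive_divn => [n|n m].
    by apply: ln_ge0; rewrite ler1n -(ltr0n R).
  rewrite -lnM ?posrE// ler_ln ?posrE// ?mulr_gt0//.
  rewrite -natrM ler_nat -addnS; exact: (ncosets_TnD hausG haar phi_cont).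
have mU0 : 0 < fine (mu U).
  exact: (fine_haar_gt0 hausG haar cU oU (subgroup1 sU)).
have cvgl : (fun n => lne (coset_index (Tn phi U n) U) * (n%:R^-1)%R%:E)%E
    @ \oo --> l%:E.
  rewrite [X in X @ _ --> _](_ : _ = EFin \o (fun n => ln (t n)%:R / n%:R)).
    by apply: cvg_EFin; [exact: nearW|exact: lnt].
  apply/funext => n; rewrite coset_indexE//; last exact: Tn_compact.
  by rewrite lne_EFin; [|exact: t0].
(* Passing to the measure adds ln (mu U) / n, which tends to 0. *)
suff -> : H_alg mu phi U = l%:E by [].
apply: (cvg_limn_einf_sup _).2.
have cvgc : (fun n => (ln (t n)%:R / n%:R + ln (fine (mu U)) / n%:R : R)%:E)
    @ \oo --> l%:E.
  apply: cvg_EFin; first exact: nearW.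
  rewrite -[l]addr0 -[X in l + X](mulr0 (ln (fine (mu U)))).
  apply: cvgD => //; apply: cvgM; first exact: cvg_cst.
  rewrite -cvg_shiftS; exact: cvg_harmonic.
apply: cvg_trans cvgc; apply: near_eq_cvg; near=> n.
have n0 : (0 < n)%N by near: n; exists 1%N.
rewrite -(prednK n0) measure_Tn// -[fine _ *+ _]mulr_natl.
rewrite lne_EFin; last exact: mulr_gt0 (t0 n.-1.+1) mU0.
by rewrite lnM ?posrE//; [rewrite -EFinM mulrDl|exact: (t0 n.-1.+1)].
Unshelve. all: by end_near. Qed.

End Entropy.

Theorem corollary3p2 (R : realType) (G : topologicalGroupType)
    (hausG : hausdorff_space G) (lcG : locally_compact [set: G])
    (mu : {measure set (borelType G) -> \bar R}) (haar : right_Haar_measure mu)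
    (phi : {multiplicative G -> G}) (phi_cont : continuous phi) :
  (forall U : set G, compact U -> open U -> subgroup U ->
     topologically_quasinormal U ->
     (fun n => lne (coset_index (Tn phi U n) U) * (n%:R^-1)%R%:E)%E @ \oo -->
       H_alg mu phi U) /\
  (compactly_covered G -> topologically_quasihamiltonian G ->
     h_alg mu phi =
     ereal_sup [set H_alg mu phi U |
       U in [set U : set G | [/\ compact U, open U & subgroup U]]]).
Proof.
split=> [U cU oU sU _|ccG qG]; first exact: cvg_coset_index.
apply/eqP; rewrite eq_le; apply/andP; split; apply: ge_ereal_sup.
  move=> _ [K [cK K1] <-].
  have [U [cU oU sU KU]] := compact_sub_compact_open_subgroup hausG ccG qG cK K1.
  apply: le_trans (H_alg_subset mu hausG phi_cont cK cU KU) _.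
  by apply: ereal_sup_ubound; exists U.
move=> _ [U [cU oU sU] <-].
apply: ereal_sup_ubound; exists U => //; split=> //.
by apply: open_nbhs_nbhs; split=> //; exact: subgroup1.
Qed.
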